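(* Let $K=\mathbb{R}$ or $K=\mathbb{C}$, let $(X,(\cdot,\cdot|\cdot))$ be a 2-inner product space over $K$, and let $A,a\in K$ and $x,y,z\in X$ satisfy $\mathrm{Re}\,(Ay-x,\;x-ay\,|\,z)\ge 0$ or, equivalently, $\left\|x-\frac{a+A}{2}y\,\Big|\,z\right\|\le \frac12|A-a|\,\|y|z\|$. If $\mathrm{Re}(\overline{a}A)>0$, then $$\|x|z\|\,\|y|z\|\le \frac12\cdot\frac{\mathrm{Re}[(\overline{A}+\overline{a})(x,y|z)]}{[\mathrm{Re}(\overline{a}A)]^{1/2}}\le \frac12\cdot\frac{|A+a|}{[\mathrm{Re}(\overline{a}A)]^{1/2}}\,|(x,y|z)| .$$ The constant $\frac12$ is best possible in both inequalities, in the sense that it cannot be replaced by a smaller constant: there is no $C<\frac12$ such that $\|x|z\|\|y|z\|\le C\,\mathrm{Re}[(\overline{A}+\overline{a})(x,y|z)]/[\mathrm{Re}(\overline{a}A)]^{1/2}$ holds for all 2-inner product spaces $(X,(\cdot,\cdot|\cdot))$ over $K$ and all $x,y,z\in X$, $a,A\in K$ satisfying $\mathrm{Re}\,(Ay-x,\;x-ay\,|\,z)\ge 0$ and $\mathrm{Re}(\overline{a}A)>0$, and likewise there is no $C<\frac12$ such that $\|x|z\|\|y|z\|\le C\,|A+a|\,|(x,y|z)|/[\mathrm{Re}(\overline{a}A)]^{1/2}$ holds for all 2-inner product spaces $(X,(\cdot,\cdot|\cdot))$ over $K$ and all $x,y,z\in X$, $a,A\in K$ satisfying $\mathrm{Re}\,(Ay-x,\;x-ay\,|\,z)\ge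 0$ and $\mathrm{Re}(\overline{a}A)>0$.
   Context: Let $X$ be a linear space of dimension greater than $1$ over $K$, where $K=\mathbb{R}$ or $K=\mathbb{C}$. A 2-inner product on $X$ is a function $(\cdot,\cdot|\cdot):X\times X\times X\to K$ such that for all $x,x',y,z\in X$ and $\alpha\in K$: (1) $(x,x|z)\ge 0$, and $(x,x|z)=0$ if and only if $x$ and $z$ are linearly dependent; (2) $(x,x|z)=(z,z|x)$; (3) $(x,y|z)=\overline{(y,x|z)}$; (4) $(\alpha x,y|z)=\alpha(x,y|z)$; (5) $(x+x',y|z)=(x,y|z)+(x',y|z)$. The pair $(X,(\cdot,\cdot|\cdot))$ is then called a 2-inner product space over $K$. The associated 2-norm is $\|x|z\|=\sqrt{(x,x|z)}$ for $x,z\in X$. *)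

(* Defs.v *)
(* MathComp, with realType from MathComp-Analysis and R[i] from real-closed. *)
From HB Require Import structures.
From mathcomp Require Import all_boot all_order all_algebra.
From mathcomp Require Import reals.
From mathcomp.real_closed Require Import complex.

Set Implicit Arguments.
Unset Strict Implicit.
Unset Printing Implicit Defensive.

Import Order.TTheory GRing.Theory Num.Theory.
Local Open Scope ring_scope.

Inductive scalar_kind := RealScalars | ComplexScalars.

Definition scalar_field (R : realType) (k : scalar_kind) : numFieldType :=
  match k with
  | RealScalars => R
  | ComplexScalars => R[i]
  end.

Definition scalRe (R : realType) (k : scalar_kind) : scalar_field R k -> R :=
  match k return scalar_field R k -> R with
  | RealScalars => fun t => t
  | ComplexScalars => fun t => complex.Re t
  end.

Definition scalconj (R : realType) (k : scalar_kind) :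
    scalar_field R k -> scalar_field R k :=
  match k return scalar_field R k -> scalar_field R k with
  | RealScalars => fun t => t
  | ComplexScalars => fun t => conjc t
  end.

(* The norm `|t| of a numFieldType lives in the field itself; for R[i] it is a
   complex number with zero imaginary part, so scalRe only changes its type. *)
Definition scalabs (R : realType) (k : scalar_kind) (t : scalar_field R k) : R :=
  scalRe `|t|.

Definition lin_dependent (K : fieldType) (X : lmodType K) (x y : X) : Prop :=
  exists s t : K, ((s != 0) || (t != 0)) /\ s *: x + t *: y = 0.

(* X may be infinite dimensional, hence lmodType rather than vectType. *)
Definition dim_gt1 (K : fieldType) (X : lmodType K) : Prop :=
  exists u v : X, ~ lin_dependent u v.

(* In tip_ge0 the order is that of the scalars: over R[i], 0 <= t says that t
   is real and nonnegative. *)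
Record is_two_inner_product (R : realType) (k : scalar_kind)
    (X : lmodType (scalar_field R k)) (ip : X -> X -> X -> scalar_field R k) : Prop := {
  tip_ge0 : forall x z, 0 <= ip x x z;
  tip_eq0 : forall x z, ip x x z = 0 <-> lin_dependent x z;
  tip_swap : forall x z, ip x x z = ip z z x;
  tip_conj : forall x y z, ip x y z = scalconj (ip y x z);
  tip_scale : forall (s : scalar_field R k) x y z, ip (s *: x) y z = s * ip x y z;
  tip_add : forall x x' y z, ip (x + x') y z = ip x y z + ip x' y z
}.

Record two_inner_product_space (R : realType) (k : scalar_kind) := {
  tip_carrier :> lmodType (scalar_field R k);
  tip_dim_gt1 : dim_gt1 tip_carrier;
  tip : tip_carrier -> tip_carrier -> tip_carrier -> scalar_field R k;
  tip_axioms : is_two_inner_product tip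
}.

Arguments tip {R k X} x y z : rename.

Definition two_norm (R : realType) (k : scalar_kind)
    (X : two_inner_product_space R k) (x z : X) : R :=
  Num.sqrt (scalRe (tip x x z)).

(* Main.v *)
Require Import Defs.
From HB Require Import structures.
From mathcomp Require Import all_boot all_order all_algebra.
From mathcomp Require Import reals.
From mathcomp.real_closed Require Import complex.
From mathcomp Require Import ring lra.

(** The slot [z] is fixed throughout, and [tip _ _ z] is then a positive
semidefinite Hermitian form in its first two arguments.

The two forms of the hypothesis agree because of the polarisation-like identity
  Re (u - v, u + v | z) = ||u | z||^2 - ||v | z||^2
([scalRe_tip_subr_addr]), taken at u = ((A - a) / 2) y and
v = x - ((a + A) / 2) y: then u - v = A y - x and u + v = x - a y.

Expanding the same inner product directly ([scalRe_tip_expand]) turns the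
hypothesis into
  ||x | z||^2 + Re (conj a * A) ||y | z||^2
    <= Re ((conj A + conj a) (x, y | z)),
and the arithmetic-geometric mean inequality bounds the left-hand side below by
2 sqrt (Re (conj a * A)) ||x | z|| ||y | z||.  This is the first inequality; the
second one is Re t <= |t|.

Both inequalities become equalities for A = a = 1 and x = y, so a constant C is
admissible only if 1 <= 2 C as soon as some space has a vector with
||x | z|| = 1.  Such a space is the plane K^2 with
(x, y | z) = det (x, z) * conj (det (y, z)) ([det_space]).  By the Cauchy-Binet
formula this is (x, y) (z, z) - (x, z) (z, y), the standard 2-inner product of an
inner product space, and definiteness becomes the fact that a determinant
vanishes exactly when its columns are dependent ([det2_eq0]). *)

Set Implicit Arguments.
Unset Strict Implicit.
Unset Printing Implicit Defensive.

Import Order.TTheory GRing.Theory Num.Theory.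
Local Open Scope ring_scope.

(** * Real part, conjugation and modulus on both kinds of scalars *)

Section Scalars.
Variables (R : realType) (k : scalar_kind).
Implicit Types s t : scalar_field R k.

Lemma scalReD s t : scalRe (s + t) = scalRe s + scalRe t.
Proof. by case: k s t => //= s t; rewrite raddfD. Qed.

Lemma scalReN t : scalRe (- t) = - scalRe t.
Proof. by case: k t => //= t; rewrite raddfN. Qed.

Lemma scalRe1 : scalRe (1 : scalar_field R k) = 1.
Proof. by case: k. Qed.

Lemma scalRe_conj t : scalRe (scalconj t) = scalRe t.
Proof. by case: k t => //= -[]. Qed.

Lemma scalconjK t : scalconj (scalconj t) = t.
Proof. by case: k t => //= t; rewrite conjcK. Qed.

Lemma scalconjD s t : scalconj (s + t) = scalconj s + scalconj t.
Proof. by case: k s t => //= s t; rewrite rmorphD. Qed.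

Lemma scalconjN t : scalconj (- t) = - scalconj t.
Proof. by case: k t => //= t; rewrite rmorphN. Qed.

Lemma scalconjM s t : scalconj (s * t) = scalconj s * scalconj t.
Proof. by case: k s t => //= s t; rewrite rmorphM. Qed.

Lemma scalconj1 : scalconj (1 : scalar_field R k) = 1.
Proof. by case: k => //; exact: conjc1. Qed.

Lemma mul_scalconj t : t * scalconj t = `|t| ^+ 2.
Proof.
case: k t => /= t; last by rewrite sqr_normc.
by rewrite real_normK ?num_real.
Qed.

(** Nonnegativity makes [s] real, so that no product of imaginary parts occurs. *)
Lemma scalReM s t : 0 <= s -> scalRe (s * t) = scalRe s * scalRe t.
Proof.
case: k s t => //= -[a b] [c d]; rewrite lecE /= => /andP[/eqP -> _].
by rewrite mul0r subr0.
Qed.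

Lemma scalRe_ge0 t : 0 <= t -> 0 <= scalRe t.
Proof. by case: k t => //= -[a b]; rewrite lecE => /andP[]. Qed.

Lemma scalabs_ge0 t : 0 <= scalabs t.
Proof. exact: scalRe_ge0. Qed.

Lemma scalabsM s t : scalabs (s * t) = scalabs s * scalabs t.
Proof. by rewrite /scalabs normrM scalReM. Qed.

(** The modulus is a real number only through [scalRe]; doubling both sides
avoids computing the modulus of 1/2 in each field. *)
Lemma scalabs_half t : scalabs (t / 2) = 2^-1 * scalabs t.
Proof.
have: scalabs (t / 2 + t / 2) = scalabs (t / 2) + scalabs (t / 2).
  by rewrite /scalabs -mulr2n normrMn mulr2n scalReD.
have -> : t / 2 + t / 2 = t by field.
by move=> ->; field.
Qed.

Lemma scalRe_le_abs t : scalRe t <= scalabs t.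
Proof.
rewrite /scalabs; case: k t => /= t; first exact: ler_norm.
apply: le_trans (ler_norm _) _.
by have := normc_ge_Re t; rewrite lecE /= => /andP[].
Qed.

End Scalars.

(** * The Hermitian form of a 2-inner product *)

Section HermitianForm.
Variables (R : realType) (k : scalar_kind) (X : two_inner_product_space R k).
Implicit Types (s : scalar_field R k) (x y z u v : X).

Lemma tipDl x x' y z : tip (x + x') y z = tip x y z + tip x' y z.
Proof. exact: (tip_add (tip_axioms X)). Qed.

Lemma tipZl s x y z : tip (s *: x) y z = s * tip x y z.
Proof. exact: (tip_scale (tip_axioms X)). Qed.

Lemma tipC x y z : tip x y z = scalconj (tip y x z).
Proof. exact: (tip_conj (tip_axioms X)). Qed.

Lemma tipDr x y y' z : tip x (y + y') z = tip x y z + tip x y' z.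
Proof. by rewrite tipC tipDl scalconjD -!tipC. Qed.

Lemma tipZr s x y z : tip x (s *: y) z = scalconj s * tip x y z.
Proof. by rewrite tipC tipZl scalconjM -tipC. Qed.

Lemma tipNl x y z : tip (- x) y z = - tip x y z.
Proof. by rewrite -scaleN1r tipZl mulN1r. Qed.

Lemma tipNr x y z : tip x (- y) z = - tip x y z.
Proof. by rewrite -scaleN1r tipZr scalconjN scalconj1 mulN1r. Qed.

Lemma two_norm_ge0 x z : 0 <= two_norm x z.
Proof. exact: sqrtr_ge0. Qed.

Lemma sqr_two_norm x z : two_norm x z ^+ 2 = scalRe (tip x x z).
Proof. by rewrite sqr_sqrtr // scalRe_ge0 // (tip_ge0 (tip_axioms X)). Qed.

Lemma two_normZ s x z : two_norm (s *: x) z = scalabs s * two_norm x z.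
Proof.
rewrite /two_norm tipZl tipZr mulrA mul_scalconj scalReM ?exprn_ge0 //.
rewrite expr2 scalReM // -expr2 sqrtrM ?sqr_ge0 // sqrtr_sqr.
by rewrite ger0_norm // scalabs_ge0.
Qed.

(** The cross terms are conjugate to each other, hence have the same real
part and cancel. *)
Lemma scalRe_tip_subr_addr u v z :
  scalRe (tip (u - v) (u + v) z) = two_norm u z ^+ 2 - two_norm v z ^+ 2.
Proof.
rewrite !sqr_two_norm !tipDl !tipDr !tipNl !scalReD !scalReN.
rewrite (tipC v u) scalRe_conj; ring.
Qed.

Lemma scalRe_tip_expand (A a : scalar_field R k) x y z :
  scalRe (tip (A *: y - x) (x - a *: y) z) =
    scalRe ((scalconj A + scalconj a) * tip x y z)
    - (two_norm x z ^+ 2 + scalRe (scalconj a * A) * two_norm y z ^+ 2).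
Proof.
(* Re (A (y, x | z)) is rewritten as the real part of its conjugate, so that
   only (x, y | z) remains. *)
have ReA : scalRe (A * tip y x z) = scalRe (scalconj A * tip x y z).
  by rewrite -[LHS]scalRe_conj scalconjM -tipC.
have Rey : scalRe (A * (scalconj a * tip y y z)) =
    scalRe (scalconj a * A) * scalRe (tip y y z).
  have tyy_ge0 : 0 <= tip y y z := tip_ge0 (tip_axioms X) y z.
  by rewrite [RHS]mulrC -scalReM //; congr scalRe; ring.
rewrite !sqr_two_norm !tipDl !tipDr !tipNl !tipNr !tipZl !tipZr.
rewrite mulrDl !(scalReD, scalReN) Rey ReA; ring.
Qed.

Lemma scalRe_tip_ge0E (A a : scalar_field R k) x y z :
  0 <= scalRe (tip (A *: y - x) (x - a *: y) z) <->
  two_norm (x - ((a + A) / 2) *: y) z <= 2^-1 * scalabs (A - a) * two_norm y z.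
Proof.
pose u := ((A - a) / 2) *: y; pose v := x - ((a + A) / 2) *: y.
have -> : A *: y - x = u - v.
  by rewrite /u /v opprB addrA -scalerDl; congr (_ *: _ - _); field.
have -> : x - a *: y = u + v.
  by rewrite /u /v addrCA -scalerBl -scaleNr; congr (_ + _ *: _); field.
rewrite -/v -scalabs_half -two_normZ -/u scalRe_tip_subr_addr subr_ge0.
by rewrite ler_pXn2r ?nnegrE ?two_norm_ge0.
Qed.

Lemma two_normM_le (A a : scalar_field R k) x y z :
  0 <= scalRe (tip (A *: y - x) (x - a *: y) z) ->
  0 < scalRe (scalconj a * A) ->
  two_norm x z * two_norm y z
    <= 2^-1 * (scalRe ((scalconj A + scalconj a) * tip x y z)
               / Num.sqrt (scalRe (scalconj a * A))).
Proof.
rewrite scalRe_tip_expand subr_ge0 => bound aA_gt0.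
have r_gt0 : 0 < Num.sqrt (scalRe (scalconj a * A)) by rewrite sqrtr_gt0.
rewrite mulrA ler_pdivlMr //.
move: bound; rewrite -{1}(sqr_sqrtr (ltW aA_gt0)).
set r := Num.sqrt _; set n := two_norm x z; set m := two_norm y z => bound.
(* Arithmetic-geometric mean: (n - r m)^2 >= 0. *)
have := sqr_ge0 (n - r * m); nra.
Qed.

Lemma scalRe_tip_le_abs (A a : scalar_field R k) x y z :
  scalRe ((scalconj A + scalconj a) * tip x y z)
    <= scalabs (A + a) * scalabs (tip x y z).
Proof.
have absJ t : scalabs (scalconj t) = scalabs t :> R.
  (* Both squares are equal to t * conj t. *)
  apply/eqP; rewrite -(@eqrXn2 _ 2) ?scalabs_ge0 // !expr2 /scalabs.
  by rewrite -!scalReM // -!expr2 -!mul_scalconj scalconjK mulrC.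
by apply: le_trans (scalRe_le_abs _) _; rewrite scalabsM -scalconjD absJ.
Qed.

End HermitianForm.

(** * The determinant 2-inner product on the plane *)

Definition det2 (K : fieldType) (x z : (K^o * K^o)%type) : K :=
  x.1 * z.2 - x.2 * z.1.

(** If s x + t z = 0 then both s and t kill the determinant; conversely, a
nonzero coordinate of z makes the determinant itself the missing relation. *)
Lemma det2_eq0 (K : fieldType) (x z : (K^o * K^o)%type) :
  det2 x z = 0 <-> lin_dependent x z.
Proof.
case: x z => [x1 x2] [z1 z2]; rewrite /det2 /=; split.
  move=> det0.
  (* The coefficients are read off a nonzero coordinate of z. *)
  have [z20|z2_neq0] := eqVneq z2 0; last first.
    exists z2, (- x2); rewrite z2_neq0; split=> //; congr pair => /=.
      rewrite -[RHS]det0 /GRing.scale /=; ring.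
    rewrite /GRing.scale /=; ring.
  have [z10|z1_neq0] := eqVneq z1 0; last first.
    exists z1, (- x1); rewrite z1_neq0; split=> //; congr pair => /=.
      rewrite /GRing.scale /=; ring.
    rewrite -[RHS]oppr0 -[in RHS]det0 /GRing.scale /=; ring.
  exists 0, 1; rewrite oner_eq0 orbT; split=> //.
  by rewrite scale0r add0r z10 z20 scale1r.
case=> s [t [st_neq0 []]]; rewrite /GRing.scale /= => e1 e2.
have e1z : s * x1 = - (t * z1) by apply/eqP; rewrite -addr_eq0 e1.
have e2z : s * x2 = - (t * z2) by apply/eqP; rewrite -addr_eq0 e2.
have sdet : s * (x1 * z2 - x2 * z1) = 0.
  by rewrite mulrBr !mulrA e1z e2z; ring.
have tdet : t * (x1 * z2 - x2 * z1) = 0.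
  have -> : t * (x1 * z2 - x2 * z1) = x1 * (t * z2) - x2 * (t * z1) by ring.
  have -> : t * z2 = - (s * x2) by rewrite e2z opprK.
  have -> : t * z1 = - (s * x1) by rewrite e1z opprK.
  ring.
case/orP: st_neq0 => neq0; apply/eqP.
  by move/eqP: sdet; rewrite mulf_eq0 (negPf neq0).
by move/eqP: tdet; rewrite mulf_eq0 (negPf neq0).
Qed.

Section DetSpace.
Variables (R : realType) (k : scalar_kind).
Local Notation K := (scalar_field R k).
Local Notation plane := (K^o * K^o)%type.

Definition det_ip (x y z : plane) : K := det2 x z * scalconj (det2 y z).

Lemma det_ip_axioms : is_two_inner_product det_ip.
Proof.
split.
- by move=> x z; rewrite /det_ip mul_scalconj exprn_ge0.
- move=> x z; rewrite /det_ip mul_scalconj -det2_eq0; split.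
    by move/eqP; rewrite expf_eq0 /= normr_eq0 => /eqP.
  by move=> ->; rewrite normr0 expr0n.
- move=> x z; rewrite /det_ip !mul_scalconj -normrN.
  by congr (`|_| ^+ 2); rewrite /det2; ring.
- by move=> x y z; rewrite /det_ip scalconjM scalconjK mulrC.
- move=> s x y z; rewrite /det_ip mulrA; congr (_ * _).
  rewrite /det2 /= /GRing.scale /=; ring.
- move=> x x' y z; rewrite /det_ip -mulrDl; congr (_ * _).
  rewrite /det2 /=; ring.
Qed.

Lemma det2_unit : det2 ((1, 0) : plane) (0, 1) = 1.
Proof. by rewrite /det2 /= mulr1 mul0r subr0. Qed.

Lemma plane_dim_gt1 : dim_gt1 plane.
Proof.
exists (1, 0), (0, 1) => /det2_eq0 /eqP.
by rewrite det2_unit oner_eq0.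
Qed.

Definition det_space : two_inner_product_space R k :=
  {| tip_dim_gt1 := plane_dim_gt1; tip_axioms := det_ip_axioms |}.

Lemma exists_tip_eq1 :
  exists (X : two_inner_product_space R k) (x z : X), tip x x z = 1.
Proof.
exists det_space, (1, 0), (0, 1).
by rewrite /tip /= /det_ip det2_unit mul1r scalconj1.
Qed.

End DetSpace.

Theorem theorem2p2 (R : realType) (k : scalar_kind) :
  (forall (X : two_inner_product_space R k) (A a : scalar_field R k) (x y z : X),
      (0 <= scalRe (tip (A *: y - x) (x - a *: y) z)
       <-> two_norm (x - ((a + A) / 2) *: y) z
           <= 2^-1 * scalabs (A - a) * two_norm y z)
      /\
      (0 <= scalRe (tip (A *: y - x) (x - a *: y) z) ->
       0 < scalRe (scalconj a * A) ->
       two_norm x z * two_norm y z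
         <= 2^-1 * (scalRe ((scalconj A + scalconj a) * tip x y z)
                    / Num.sqrt (scalRe (scalconj a * A)))
       /\
       2^-1 * (scalRe ((scalconj A + scalconj a) * tip x y z)
               / Num.sqrt (scalRe (scalconj a * A)))
         <= 2^-1 * (scalabs (A + a) / Num.sqrt (scalRe (scalconj a * A)))
            * scalabs (tip x y z)))
  /\
  (~ exists C : R, C < 2^-1 /\
      forall (X : two_inner_product_space R k) (A a : scalar_field R k) (x y z : X),
        0 <= scalRe (tip (A *: y - x) (x - a *: y) z) ->
        0 < scalRe (scalconj a * A) ->
        two_norm x z * two_norm y z
          <= C * (scalRe ((scalconj A + scalconj a) * tip x y z)
                  / Num.sqrt (scalRe (scalconj a * A))))
  /\
  (~ exists C : R, C < 2^-1 /\
      forall (X : two_inner_product_space R k) (A a : scalar_field R k) (x y z : X),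
        0 <= scalRe (tip (A *: y - x) (x - a *: y) z) ->
        0 < scalRe (scalconj a * A) ->
        two_norm x z * two_norm y z
          <= C * (scalabs (A + a) / Num.sqrt (scalRe (scalconj a * A)))
             * scalabs (tip x y z)).
Proof.
split.
  move=> X A a x y z; split; first exact: scalRe_tip_ge0E.
  move=> tip_ge0 aA_gt0; split; first exact: two_normM_le.
  rewrite -mulrA ler_pM2l ?invr_gt0 // mulrAC.
  by rewrite ler_pM2r ?invr_gt0 ?sqrtr_gt0 // scalRe_tip_le_abs.
have [X [x [z tip1]]] := exists_tip_eq1 R k.
pose one : scalar_field R k := 1.
(* The extremal configuration A = a = 1, x = y. *)
have hyp : 0 <= scalRe (tip (one *: x - x) (x - one *: x) z).
  by rewrite /one scale1r subrr -(scale0r x) tipZl mul0r scalRe_ge0.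
have aA1 : scalRe (scalconj one * one) = 1.
  by rewrite /one scalconj1 mulr1 scalRe1.
have norm1 : two_norm x z = 1 by rewrite /two_norm tip1 scalRe1 sqrtr1.
split=> -[C [C_lt bound]].
  have := bound X one one x x z hyp.
  rewrite aA1 norm1 tip1 /one scalconj1 !mulr1 scalReD scalRe1 sqrtr1.
  by move=> /(_ ltr01); lra.
have := bound X one one x x z hyp.
rewrite aA1 norm1 tip1 /scalabs ger0_norm ?addr_ge0 ?ler01 // normr1.
rewrite scalReD scalRe1 sqrtr1 => /(_ ltr01); lra.
Qed.
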